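(* Let $\mathbb{K}=\mathbb{R}$ or $\mathbb{C}$, let $n\ge 3$, and let $\mathfrak{g}$ be a complete solvable Lie algebra over $\mathbb{K}$ whose nilradical is isomorphic to the filiform Lie algebra $\mathrm{L}_n$. Then $\mathfrak{g}$ is symplectic (i.e. admits a symplectic form) if and only if $n=4$.
   Context: A finite-dimensional Lie algebra $\mathfrak{g}$ is complete if its center is trivial and all its derivations are inner. $\mathrm{L}_n$ is the $n$-dimensional Lie algebra with basis $e_1,\dots,e_n$ and nonzero brackets (up to skew-symmetry) $[e_1,e_i]=e_{i+1}$ for $2\le i\le n-1$. Up to isomorphism, the complete solvable Lie algebra with nilradical $\mathrm{L}_n$ is $\mathfrak{g}=\mathfrak{h}\ltimes\mathrm{L}_n$ with $\mathfrak{h}=\mathrm{span}(e_{n+1},e_{n+2})$ abelian and, in addition to the brackets of $\mathrm{L}_n$, $[e_{n+1},e_1]=e_1$, $[e_{n+1},e_i]=(i-2)e_i$ and $[e_{n+2},e_i]=e_i$ for $2\le i\le n$ (and $[e_{n+2},e_1]=0$). A symplectic form on $\mathfrak{g}$ is a non-degenerate skew-symmetric bilinear form $\omega$ with $\omega([x,y],z)+\omega([y,z],x)+\omega([z,x],y)=0$ for all $x,y,z\in\mathfrak{g}$. *)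

(* Defs.v *)
From HB Require Import structures.
From mathcomp Require Import all_boot all_order all_algebra.
From mathcomp Require Import reals complex.

Set Implicit Arguments.
Unset Strict Implicit.
Unset Printing Implicit Defensive.

Import GRing.Theory.
Local Open Scope ring_scope.

(* [R : realType] ranges over the (pairwise isomorphic) models of the reals.  *)
Inductive real_or_complex (R : realType) : fieldType -> Prop :=
  | RealField : real_or_complex R R
  | ComplexField : real_or_complex R R[i].

HB.mixin Record Vector_isLieAlgebra (K : fieldType) g of Vector K g := {
  lie : g -> g -> g;
  lie_bilinear : bilinear_for *:%R *:%R lie;
  liexx : forall x, lie x x = 0;
  lie_jacobi : forall x y z,
    lie x (lie y z) + lie y (lie z x) + lie z (lie x y) = 0
}.

(* A [vectType] is finite-dimensional, hence so is a [lieAlgType].            *)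
#[short(type="lieAlgType")]
HB.structure Definition LieAlgebra (K : fieldType) :=
  { g of Vector K g & Vector_isLieAlgebra K g }.

HB.instance Definition _ (K : fieldType) (g : lieAlgType K) :=
  bilinear_isBilinear.Build K g g g *:%R *:%R (@lie K g) lie_bilinear.

Section Lie.
Context {K : fieldType} {g : lieAlgType K}.
Implicit Types (x y z : g) (U V I N : {vspace g}).

Definition lie_prodv U V : {vspace g} :=
  <<[seq lie x y | x <- vbasis U, y <- vbasis V]>>%VS.

Lemma memv_lie U V x y : x \in U -> y \in V -> lie x y \in lie_prodv U V.
Proof.
move=> /coord_vbasis-> /coord_vbasis->.
rewrite linear_sumlz; apply: memv_suml => i _.
rewrite linear_sumr; apply: memv_suml => j _.
rewrite linearZl linearZr !memvZ // memv_span //.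
by apply: allpairs_f; apply: mem_nth; rewrite size_tuple.
Qed.

Lemma lie_prodvP {U V W : {vspace g}} :
  reflect {in U & V, forall x y, lie x y \in W} (lie_prodv U V <= W)%VS.
Proof.
apply: (iffP idP) => [sUVW x y Ux Vy | sUVW].
  by rewrite (subvP sUVW) ?memv_lie.
apply/span_subvP => _ /allpairsP[[x y] /= [Ux Vy ->]].
by apply: sUVW; apply: vbasis_mem.
Qed.

Definition lie_ideal I : bool := (lie_prodv fullv I <= I)%VS.

Fixpoint derived_series U (k : nat) : {vspace g} :=
  if k is k'.+1 then lie_prodv (derived_series U k') (derived_series U k')
  else U.

Fixpoint lower_central_series U (k : nat) : {vspace g} :=
  if k is k'.+1 then lie_prodv U (lower_central_series U k') else U.

Definition lie_nilpotent U : Prop :=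
  exists k, lower_central_series U k = 0%VS.

Definition is_nilradical N : Prop :=
  [/\ lie_ideal N, lie_nilpotent N
    & forall I, lie_ideal I -> lie_nilpotent I -> (I <= N)%VS].

Definition lie_derivation (D : 'End(g)) : Prop :=
  forall x y, D (lie x y) = lie (D x) y + lie x (D y).

Definition inner_derivation (D : 'End(g)) : Prop :=
  exists z, forall x, D x = lie z x.

End Lie.

Definition lie_solvable (K : fieldType) (g : lieAlgType K) : Prop :=
  exists k, derived_series (fullv : {vspace g}) k = 0%VS.

Definition lie_complete (K : fieldType) (g : lieAlgType K) : Prop :=
  (forall x : g, (forall y, lie x y = 0) -> x = 0)
  /\ (forall D : 'End(g), lie_derivation D -> inner_derivation D).

(* [l] is isomorphic to the subalgebra of [g] carried by [N].                 *)
Definition lie_isomorphic_to (K : fieldType) (l g : lieAlgType K)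
    (N : {vspace g}) : Prop :=
  exists f : 'Hom(l, g), [/\ lker f = 0%VS, limg f = N
    & forall x y, f (lie x y) = lie (f x) (f y)].

Definition lie_symplectic (K : fieldType) (g : lieAlgType K) : Prop :=
  exists w : {skew_symmetric g}, nondegenerate w /\
    (forall x y z, w (lie x y) z + w (lie y z) x + w (lie z x) y = 0).

(* Indices start at 0: the vector e_i of the usual presentation of L_n, with  *)
(* 1 <= i <= n, is the standard basis vector of index i - 1.                  *)
Definition filiform (K : fieldType) (n : nat) : Type := 'rV[K]_n.

HB.instance Definition _ (K : fieldType) (n : nat) :=
  Vector.on (filiform K n).

Section Filiform.
Variables (K : fieldType) (n : nat).
Implicit Types x y z : 'rV[K]_n.

Definition filiform_head x : K := \sum_(i < n | i == 0 :> nat) x 0 i.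

(* ad e_1, acting on row vectors: it kills e_1 and e_n, and maps e_i to       *)
(* e_(i+1) for 2 <= i <= n - 1. As e_2, ..., e_n commute, the bracket is      *)
(* [x, y] = x_1 (ad e_1)(y) - y_1 (ad e_1)(x).                                *)
Definition filiform_shift : 'M[K]_n :=
  \matrix_(i, j) ((0 < i)%N && (j == i.+1 :> nat))%:R.

Definition filiform_lie x y : 'rV[K]_n :=
  filiform_head x *: (y *m filiform_shift)
  - filiform_head y *: (x *m filiform_shift).

Fact filiform_head_linear : scalar filiform_head.
Proof.
move=> a x y; rewrite /filiform_head mulr_sumr -big_split /=.
by apply: eq_bigr => i _; rewrite !mxE.
Qed.

Fact filiform_head_shift x : filiform_head (x *m filiform_shift) = 0.
Proof.
rewrite /filiform_head big1 // => i /eqP i0.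
by rewrite mxE big1 // => j _; rewrite mxE i0 andbF mulr0.
Qed.

Fact filiform_headB a b x y : filiform_head (a *: x - b *: y) =
  a * filiform_head x - b * filiform_head y.
Proof.
have hZ c z : filiform_head (c *: z) = c * filiform_head z.
  by rewrite /filiform_head mulr_sumr; apply: eq_bigr => i _; rewrite mxE.
by rewrite filiform_head_linear -scaleNr hZ mulNr.
Qed.

Fact filiform_lie_bilinear : bilinear_for *:%R *:%R filiform_lie.
Proof.
split=> [y a x1 x2 | x a y1 y2]; rewrite /filiform_lie filiform_head_linear.
  rewrite mulmxDl -scalemxAl scalerDl /= scalerBr scalerDr !scalerA.
  by rewrite [_ * a]mulrC opprD addrACA.
rewrite mulmxDl -scalemxAl scalerDl /= scalerBr scalerDr !scalerA.
by rewrite [_ * a]mulrC opprD addrACA.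
Qed.

Fact filiform_liexx x : filiform_lie x x = 0.
Proof. exact: subrr. Qed.

Fact filiform_jacobi x y z :
  filiform_lie x (filiform_lie y z) + filiform_lie y (filiform_lie z x)
  + filiform_lie z (filiform_lie x y) = 0.
Proof.
rewrite /filiform_lie !filiform_headB !filiform_head_shift !mulr0 !subrr.
rewrite !scale0r !subr0 !mulmxBl -!scalemxAl !scalerBr !scalerA.
rewrite [filiform_head y * filiform_head x]mulrC.
rewrite [filiform_head z * filiform_head x]mulrC.
rewrite [filiform_head z * filiform_head y]mulrC.
by rewrite [X in X + _]addrC !subrKA subrr.
Qed.

End Filiform.

HB.instance Definition _ (K : fieldType) (n : nat) :=
  Vector_isLieAlgebra.Build K (filiform K n) (@filiform_lie_bilinear K n)
    (@filiform_liexx K n) (@filiform_jacobi K n).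

Definition filiform_basis (K : fieldType) (n : nat) (i : 'I_n) : filiform K n :=
  delta_mx 0 i.

Lemma lie_filiform_basis (K : fieldType) (n : nat) (i j : 'I_n) : (i <= j)%N ->
  lie (filiform_basis K i) (filiform_basis K j) =
  \sum_(k < n | [&& i == 0 :> nat, 0 < j & k == j.+1 :> nat]%N)
    filiform_basis K k.
Proof.
have headE (k : 'I_n) : filiform_head (delta_mx 0 k) = (k == 0 :> nat)%:R :> K.
  rewrite /filiform_head big_mkcond (bigD1 k) //= mxE !eqxx big1 ?addr0.
    by case: eqP.
  by move=> l /negPf lk; rewrite mxE lk andbF if_same.
move=> le_ij; apply/rowP => l.
rewrite [LHS](_ : _ = filiform_lie (delta_mx 0 i) (delta_mx 0 j) 0 l) //.
rewrite /filiform_lie !headE -!rowE !mxE summxE big_mkcond (bigD1 l) //=.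
rewrite big1 ?addr0; last first.
  by move=> k /negPf kl; case: ifP => // _; rewrite mxE eq_sym kl andbF.
rewrite mxE !eqxx.
case: (posnP i) le_ij => [->|i_gt0]; first by rewrite mul1r mulr0 subr0; case: andP.
by move=> /(leq_trans i_gt0); case: (posnP j) => [->|_ _]//; rewrite !mul0r subr0.
Qed.

(* Main.v *)
(* Write N for the nilradical, with generators e0, e1 and T = ad e0, so that N
   has basis e0, e1, T e1, T^2 e1, ...  For n > 3 the span A of the T^k e1 is an
   abelian ideal of g, and u in g acts on T^k e1 with weight k a(u) + b(u) modulo
   higher terms, where a(u) and b(u) are the diagonal entries of ad u at e0 and
   e1. The common kernel of a and b is an ideal acting nilpotently on N, hence it
   is N because g is solvable; so dim g <= n + 2. If dim g = n + 1, say
   g = N + K x, then some outer derivation of N commutes with ad x modulo inner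
   derivations; it extends to an outer derivation of g, against completeness.
   Hence dim g = n + 2, and some y has weights a(y) = 0, b(y) = 1. As ad y is
   unipotent on A, every closed form vanishes on A, which is thus isotropic of
   dimension n - 1 in dimension n + 2: n <= 4. For n = 4 the differential of a
   suitable linear form is symplectic. For n = 3 the same scheme, with the action
   of g on the plane N / [N, N] instead of (a, b), gives dim g = 5, which is odd. *)
Require Import Defs.
From HB Require Import structures.
From mathcomp Require Import all_boot all_order all_algebra.
From mathcomp Require Import reals complex.
From mathcomp Require Import ring.

Set Implicit Arguments.
Unset Strict Implicit.
Unset Printing Implicit Defensive.

Import GRing.Theory.
Local Open Scope ring_scope.

Lemma linear_lfun (K : fieldType) (U V : vectType K) (h : U -> V) :
  linear h -> exists H : 'Hom(U, V), H =1 h.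
Proof.
move=> hlin; pose hM := GRing.isLinear.Build K U V *:%R h hlin.
pose hL : {linear U -> V} := HB.pack h hM.
by exists (linfun hL) => u; rewrite lfunE.
Qed.

(** * Ideals and the nilradical *)

Section LieTheory.
Context {K : fieldType} {g : lieAlgType K}.
Implicit Types (x y z u v w : g) (N P U V : {vspace g}).

Lemma lieDl x y z : lie (x + y) z = lie x z + lie y z.
Proof. exact: linearDl. Qed.
Lemma lieDr x y z : lie x (y + z) = lie x y + lie x z.
Proof. exact: linearDr. Qed.
Lemma lieNl x y : lie (- x) y = - lie x y.
Proof. exact: linearNl. Qed.
Lemma lieNr x y : lie x (- y) = - lie x y.
Proof. exact: linearNr. Qed.
Lemma lieBl x y z : lie (x - y) z = lie x z - lie y z.
Proof. exact: linearBl. Qed.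
Lemma lieBr x y z : lie x (y - z) = lie x y - lie x z.
Proof. exact: linearBr. Qed.
Lemma lieZl (a : K) x y : lie (a *: x) y = a *: lie x y.
Proof. exact: linearZl_LR. Qed.
Lemma lieZr (a : K) x y : lie x (a *: y) = a *: lie x y.
Proof. exact: linearZr_LR. Qed.
Lemma lie0l x : lie 0 x = 0.
Proof. exact: linear0l. Qed.
Lemma lie0r x : lie x 0 = 0.
Proof. exact: linear0r. Qed.

Lemma lieC x y : lie x y = - lie y x.
Proof.
apply/eqP; rewrite -subr_eq0 opprK; apply/eqP.
by have := liexx (x + y); rewrite lieDl !lieDr !liexx add0r addr0.
Qed.

Lemma lie_lier x y z : lie x (lie y z) = lie (lie x y) z + lie y (lie x z).
Proof.
have := lie_jacobi x y z; rewrite (lieC z (lie x y)) (lieC z x) lieNr.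
by move=> /eqP; rewrite -addrA -opprD subr_eq0 addrC => /eqP.
Qed.

Lemma lie_liel x y z : lie (lie x y) z = lie x (lie y z) - lie y (lie x z).
Proof. by rewrite lie_lier addrK. Qed.

Lemma lie_idealP P : reflect (forall u w, w \in P -> lie u w \in P)
  (lie_ideal P).
Proof.
apply: (iffP lie_prodvP) => [idP u w Pw | idP u w _ Pw]; last exact: idP.
by rewrite idP ?memvf.
Qed.

Lemma ideal_liel P : lie_ideal P -> forall u w, u \in P -> lie u w \in P.
Proof. by move=> /lie_idealP idP u w Pu; rewrite lieC memvN idP. Qed.

Fact lie_linear u : linear (lie u).
Proof. by move=> a x y; rewrite lieDr lieZr. Qed.

HB.instance Definition _ u :=
  GRing.isLinear.Build K g g *:%R (lie u) (lie_linear u).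

Definition ad u : 'End(g) := linfun (lie u).

Lemma adE u w : ad u w = lie u w.
Proof. by rewrite /ad lfunE. Qed.

Lemma lie_ideal_lie_prodv P Q : lie_ideal P -> lie_ideal Q ->
  lie_ideal (lie_prodv P Q).
Proof.
move=> /lie_idealP idP /lie_idealP idQ; apply/lie_idealP => u w PQw.
have: (lie_prodv P Q <= ad u @^-1: lie_prodv P Q)%VS.
  apply/lie_prodvP => p q Pp Qq; rewrite -memv_preim adE.
  by rewrite lie_lier memvD ?memv_lie ?idP ?idQ.
by move/subvP => /(_ w PQw); rewrite -memv_preim adE.
Qed.

Lemma derived_series_ideal P k : lie_ideal P -> lie_ideal (derived_series P k).
Proof.
by move=> idP; elim: k => //= k IHk; apply: lie_ideal_lie_prodv.
Qed.

Lemma lie_prodvS U1 U2 V1 V2 : (U1 <= V1)%VS -> (U2 <= V2)%VS ->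
  (lie_prodv U1 U2 <= lie_prodv V1 V2)%VS.
Proof.
move=> /subvP sU1 /subvP sU2; apply/lie_prodvP => x y Ux Uy.
by rewrite memv_lie ?sU1 ?sU2.
Qed.

Lemma derived_seriesS U V k : (U <= V)%VS ->
  (derived_series U k <= derived_series V k)%VS.
Proof. by move=> sUV; elim: k => //= k IHk; apply: lie_prodvS. Qed.

Lemma ideal_lie_prodv_sub P U : lie_ideal P -> (lie_prodv P U <= P)%VS.
Proof. by move=> idP; apply/lie_prodvP => u v Pu _; apply: ideal_liel. Qed.

Lemma derived_series_sub P k : lie_ideal P -> (derived_series P k <= P)%VS.
Proof.
move=> idP; elim: k => //= k IHk.
by apply: subv_trans (lie_prodvS IHk IHk) _; apply: ideal_lie_prodv_sub.
Qed.

(** By induction, the term of index [k.+1] of the lower central series of [P] lies in [F k]. *)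
Lemma ideal_flag_nilpotent P (F : nat -> {vspace g}) (m : nat) :
  (lie_prodv P P <= F 0%N)%VS -> (forall k, lie_prodv P (F k) <= F k.+1)%VS ->
  F m = 0%VS -> lie_nilpotent P.
Proof.
move=> sPF sF Fm; exists m.+1; apply/eqP; rewrite -subv0 -Fm.
elim: {Fm} m => //= k IHk.
by apply: subv_trans (sF k); apply: lie_prodvS.
Qed.

(* Descends the derived series of P: each term is an ideal acting nilpotently
   on N whose derived ideal is already inside N. *)
Lemma ideal_flag_sub_nilradical N P (F : nat -> {vspace g}) (m : nat) :
    lie_solvable g -> is_nilradical N -> lie_ideal P ->
    F 0%N = N -> (forall k, lie_prodv P (F k) <= F k.+1)%VS -> F m = 0%VS ->
  (P <= N)%VS.
Proof.
move=> [d gd0] [_ _ maxN] idP F0 sF Fm.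
have : (derived_series P d <= N)%VS.
  have := derived_seriesS d (subvf P).
  by rewrite gd0 subv0 => /eqP ->; rewrite sub0v.
elim: d {gd0} => //= d IHd sdN; apply: IHd.
apply: maxN; first exact: derived_series_ideal.
apply: (@ideal_flag_nilpotent _ F m) => // [|k]; first by rewrite F0.
by apply: subv_trans (sF k); rewrite lie_prodvS ?derived_series_sub.
Qed.

(* e0 and e1 stand for the paper's e_1 and e_2; [c 0] and [c k.+1] are the
   coordinates along e0 and (ad e0)^k e1, extended to linear forms on g. *)
Record filiform_frame (n : nat) (N : {vspace g}) (e0 e1 : g)
    (c : nat -> {scalar g}) : Prop := FiliformFrame {
  frame_dim : \dim N = n;
  frame_e0 : e0 \in N;
  frame_e1 : e1 \in N;
  coord_e0 : forall k, (k < n)%N -> c k e0 = (k == 0)%:R;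
  coord_e1 : forall k, (k < n)%N -> c k e1 = (k == 1)%:R;
  frame_lie : {in N &, forall v w,
    lie v w = c 0%N v *: lie e0 w - c 0%N w *: lie e0 v};
  coord_shift0 : forall w, w \in N -> c 0%N (lie e0 w) = 0;
  coord_shift1 : forall w, w \in N -> c 1%N (lie e0 w) = 0;
  coord_shift : forall w k, w \in N -> (k.+2 < n)%N ->
    c k.+2 (lie e0 w) = c k.+1 w;
  frame_shift_surj : forall w, w \in N -> c 0%N w = 0 -> c 1%N w = 0 ->
    exists v, [/\ v \in N, c 0%N v = 0 & w = lie e0 v];
  frame_shift_nil : forall w, w \in N -> iter n.-1 (lie e0) w = 0
}.

Lemma filiform_frame_exists n N : lie_isomorphic_to (filiform K n) N ->
  (2 < n)%N -> exists e0 e1 c, filiform_frame n N e0 e1 c.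
Proof.
case: n => // n [f [kf fN fM]] n2.
(* The inverse [f^-1] is linear on all of [g], so coordinates on [N] extend to linear forms on
   [g]. *)
pose C u : 'rV[K]_n.+1 := (f^-1)%VF u.
have fK (v : filiform K n.+1) : C (f v) = v by rewrite /C lker0_lfunK ?kf.
have fC w : w \in N -> f (C w) = w by rewrite -fN; apply: limg_lfunVK.
(* Out of range [inord k] is index 0, so [c k] is meaningful only for [k <= n]. *)
have [c cE] : exists c : nat -> {scalar g}, forall k u, c k u = C u 0 (inord k).
  pose h k u := C u 0 (inord k).
  have hlin k : scalar (h k) by move=> a u v; rewrite /h /C linearP !mxE.
  exists (fun k => HB.pack (h k)
    (GRing.isLinear.Build K g K *%R (h k) (hlin k)) : {scalar g}).
  by [].
have headE (v : 'rV[K]_n.+1) : filiform_head v = v 0 (inord 0).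
  rewrite /filiform_head (big_pred1 (inord 0)) // => i.
  by rewrite /= -val_eqE /= inordK.
pose b k : filiform K n.+1 := delta_mx 0 (inord k).
have bC k j : (k < n.+1)%N -> (j < n.+1)%N -> b k 0 (inord j) = (j == k)%:R.
  by move=> kn jn; rewrite mxE eqxx /= -val_eqE /= !inordK.
have shiftE (v : 'rV[K]_n.+1) j : (j.+2 < n.+1)%N ->
    (v *m filiform_shift K n.+1) 0 (inord j.+2) = v 0 (inord j.+1).
  move=> jn; have j1n := ltnW jn.
  rewrite mxE (bigD1 (inord j.+1)) //= mxE !inordK // eqxx mulr1.
  rewrite big1 ?addr0 // => i; rewrite -val_eqE /= inordK // => ij.
  by rewrite mxE !inordK // eqSS (eq_sym j.+1) (negPf ij) andbF mulr0.
have shift0 (v : 'rV[K]_n.+1) : (v *m filiform_shift K n.+1) 0 (inord 0) = 0.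
  by rewrite mxE big1 // => i _; rewrite mxE inordK // andbF mulr0.
have shift1 (v : 'rV[K]_n.+1) : (v *m filiform_shift K n.+1) 0 (inord 1) = 0.
  rewrite mxE big1 // => i _; rewrite mxE inordK ?(ltnW n2) //.
  by rewrite eqSS; case: (val i) => [|k]; rewrite ?andbF mulr0.
have lieE (v w : filiform K n.+1) : lie v w =
  (v 0 (inord 0) *: (w *m filiform_shift K n.+1)
    - w 0 (inord 0) *: (v *m filiform_shift K n.+1) : 'rV__).
  by rewrite -!headE.
have n1 := ltnW n2.
have lie0E (w : filiform K n.+1) :
    lie (b 0) w = (w *m filiform_shift K n.+1 : 'rV__).
  rewrite lieE bC // eqxx scale1r.
  rewrite (_ : b 0 *m filiform_shift K n.+1 = 0) ?scaler0 ?subr0 //.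
  rewrite -rowE; apply/rowP => j; rewrite !mxE inordK //.
have fTE w : w \in N ->
    lie (f (b 0)) w = f (C w *m filiform_shift K n.+1 : 'rV__).
  by move=> Nw; rewrite -{1}(fC _ Nw) -fM lie0E.
have Nf (v : filiform K n.+1) : f v \in N by rewrite -fN memv_img ?memvf.
exists (f (b 0)), (f (b 1)), c; split => //.
- rewrite -fN limg_dim_eq; first by rewrite dimvf dim_matrix mul1r.
  by rewrite kf capv0.
- by move=> k kn; rewrite cE fK bC.
- by move=> k kn; rewrite cE fK bC.
- move=> v w Nv Nw; rewrite !cE !fTE // -{1}(fC v) // -{1}(fC w) // -fM lieE.
  by rewrite linearB !linearZ.
- by move=> w Nw; rewrite cE fTE // fK shift0.
- by move=> w Nw; rewrite cE fTE // fK shift1.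
- by move=> w k Nw kn; rewrite !cE fTE // fK shiftE.
- move=> w Nw; rewrite !cE => w0 w1.
  (* Shifting the coordinates of [w] back by one gives a preimage under [ad e0]; entry 0 is set to
     zero so that [c 0] vanishes on it. *)
  pose v : filiform K n.+1 :=
    \row_(j < n.+1) if (0 < j)%N && (j < n)%N then C w 0 (inord j.+1) else 0.
  exists (f v); split=> //; first by rewrite cE fK mxE inordK.
  rewrite fTE // fK -{1}(fC w) //; congr (f _); apply/rowP => j.
  have -> : j = inord j by rewrite inord_val.
  case: (val j) (ltn_ord j) => [|[|k]] kn; rewrite ?shift0 ?shift1 ?w0 ?w1 //.
  rewrite shiftE // mxE /= inordK ?(ltnW kn) //.
  by move: kn; rewrite ltnS => ->.
- move=> w Nw /=.
  have iterN k : iter k (lie (f (b 0))) w \in N.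
    by elim: k => //= k IHk; rewrite fTE ?Nf.
  (* After [k > 0] applications the coordinates of index at most [k] vanish: the first application
     kills indices 0 and 1 together. *)
  suff ck k j : (j < k.+1)%N -> (j < n.+1)%N ->
      (0 < k)%N -> C (iter k (lie (f (b 0))) w) 0 (inord j) = 0.
    rewrite -[LHS]fC //; rewrite [C _](_ : _ = 0) ?linear0 //.
    apply/rowP => j; rewrite [RHS]mxE -(inord_val j) ck //.
  elim: k j => // k IHk [|[|j]] jk jn _ /=; rewrite fTE // fK ?shift0 ?shift1 //.
  by rewrite shiftE // IHk // ?(ltnW jn) //; case: (k) jk.
Qed.

End LieTheory.

Lemma coord_vbasis_inj (K : fieldType) (V : vectType K) (u v : V) :
  (forall i, coord (vbasis fullv) i u = coord (vbasis fullv) i v) -> u = v.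
Proof.
move=> uv; rewrite (coord_vbasis (memvf u)) (coord_vbasis (memvf v)).
by apply: eq_bigr => i _; rewrite uv.
Qed.

(* Identities between linear combinations of vectors, by coordinates. *)
Ltac module :=
  apply: coord_vbasis_inj => ?;
  rewrite ?(linear0, linearD, linearB, linearN, linearZ) /=; ring.

(** * Derivations in codimension one *)

(** [p] reads the coordinate on the line of [x] after projection along [N]. *)
Lemma scalar_separation (K : fieldType) (V : vectType K) (N : {vspace V})
    (x : V) : x \notin N ->
  exists p : {scalar V}, p x = 1 /\ {in N, forall w, p w = 0}.
Proof.
move=> Nx; have x0 : x != 0 by apply/eqP => x0; move: Nx; rewrite x0 mem0v.
have xN0 : (<[x]> :&: N = 0)%VS.
  apply/eqP; rewrite -subv0; apply/subvP => _ /memv_capP[/vlineP[a ->]].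
  have [-> | a0] := eqVneq a 0; first by rewrite scale0r !mem0v.
  by move=> /(memvZ a^-1); rewrite scalerA mulVf // scale1r (negPf Nx).
have [f [fx fN]] : exists f : 'End(V), f x = x /\ {in N, forall w, f w = 0}.
  exists (daddv_pi <[x]> N); split; first by rewrite daddv_pi_id ?memv_line.
  move=> w Nw; have := daddv_pi_add xN0 (subvP (addvSr _ _) w Nw).
  rewrite [X in _ + X]daddv_pi_id ?[(N :&: _)%VS]capvC //.
  by move=> /(canRL (addrK _)); rewrite subrr.
pose h u := coord [tuple x] ord0 (f u).
have hlin : scalar h by move=> a u v; rewrite /h !linearP.
exists (HB.pack h (GRing.isLinear.Build K V K *%R h hlin) : {scalar V}).
split=> [|w Nw] /=; last by rewrite /h fN // linear0.
by rewrite /h fx (@coord_free _ _ _ [tuple x] ord0 ord0) //= seq1_free.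
Qed.

Section Codim1.
Context {K : fieldType} {g : lieAlgType K}.
Implicit Types (x y z u v w : g) (N P U V : {vspace g}).

(** As [g = N + K x], sending [x] to [v] extends [D] to [g]. The last hypothesis is the Leibniz rule
    on pairs [x, w], so the extension is a derivation, inner by completeness. *)
Lemma codim1_derivation_inner N x (D : 'End(g)) v :
    lie_complete g -> lie_ideal N -> x \notin N ->
    (forall u, exists a, u - a *: x \in N) ->
    {in N &, forall w w', D (lie w w') = lie (D w) w' + lie w (D w')} ->
    {in N, forall w, D (lie x w) = lie v w + lie x (D w)} ->
  exists z, {in N, forall w, D w = lie z w}.
Proof.
move=> [_ inner] idN Nx Nfull derN derx.
have [p [px pN]] := scalar_separation Nx.
have pP u : u - p u *: x \in N.
  have [a Na] := Nfull u.
  have := pN _ Na; rewrite linearB linearZ /= px mulr1 => /eqP.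
  by rewrite subr_eq0 => /eqP ->.
pose h u := D (u - p u *: x) + p u *: v.
have hlin : linear h.
  by move=> a u u'; rewrite /h !(linearD, linearB, linearN, linearZ) /=; module.
have [H HE] := linear_lfun hlin.
have hN w : w \in N -> H w = D w.
  by move=> Nw; rewrite HE /h pN // !scale0r subr0 addr0.
have hx w a : w \in N -> H (w + a *: x) = D w + a *: v.
  move=> Nw; rewrite linearD linearZ /= hN // HE /h px !scale1r subrr linear0.
  by rewrite add0r.
suff /inner[z zP] : lie_derivation H.
  by exists z => w Nw; rewrite -hN.
move=> u u'; rewrite -(subrK (p u *: x) u) -(subrK (p u' *: x) u').
move: (pP u) (pP u'); move: (p u) (p u') => a a'.
move: (u - a *: x) (u' - a' *: x) => w w' Nw Nw'.
have -> : lie (w + a *: x) (w' + a' *: x) =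
    lie w w' - a' *: lie x w + a *: lie x w'.
  by rewrite !(lieDl, lieDr, lieZl, lieZr) liexx (lieC w x); module.
rewrite hN; last first.
  have idx := lie_idealP _ idN.
  by rewrite memvD ?memvB ?memvZ ?idx.
rewrite !hx // !(linearD, linearB, linearN, linearZ) /= derN // !derx //.
rewrite !(lieDl, lieDr, lieZl, lieZr) (lieC (D w) x) (lieC v x) (lieC w v).
by module.
Qed.

End Codim1.

(** * Matrices of size two and skew-symmetric forms *)

Lemma mx2P (R : Type) (X Y : 'M[R]_2) :
  X 0 0 = Y 0 0 -> X 0 1 = Y 0 1 -> X 1 0 = Y 1 0 -> X 1 1 = Y 1 1 -> X = Y.
Proof.
move=> E00 E01 E10 E11; apply/matrixP => i j.
have ord2 (k : 'I_2) : k = 0 \/ k = 1.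
  by case: k => [[|[|]]] // lt; [left | right]; apply: val_inj.
by case: (ord2 i) (ord2 j) => [] -> [] ->.
Qed.

Lemma mulmx2E (R : pzSemiRingType) (X Y : 'M[R]_2) i j :
  (X *m Y) i j = X i 0 * Y 0 j + X i 1 * Y 1 j.
Proof.
rewrite mxE !big_ord_recl big_ord0 addr0 (_ : lift ord0 ord0 = 1) //.
exact: val_inj.
Qed.

Lemma mxtrace2E (R : pzSemiRingType) (X : 'M[R]_2) : \tr X = X 0 0 + X 1 1.
Proof.
rewrite /mxtrace !big_ord_recl big_ord0 addr0 (_ : lift ord0 ord0 = 1) //.
exact: val_inj.
Qed.

(** Commuting means that the triples of entries [01], [10], [00 - 11] of [X] and [Y] are
    proportional. That of [Y] is nonzero since [Y] is not scalar, and [b] is the ratio. *)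
Lemma mx2_centralizer (K : fieldType) (X Y : 'M[K]_2) :
  Y \notin <[1%:M]>%VS -> X *m Y = Y *m X -> exists a b, X = a%:M + b *: Y.
Proof.
move=> Yns XY.
have E i j : (X *m Y) i j = (Y *m X) i j by rewrite XY.
have offdiag : X 0 1 * Y 1 0 = X 1 0 * Y 0 1.
  have := E 0 0; rewrite !mulmx2E => E00.
  by apply: (addrI (X 0 0 * Y 0 0)); rewrite E00; ring.
have diag01 : (X 0 0 - X 1 1) * Y 0 1 = X 0 1 * (Y 0 0 - Y 1 1).
  have := E 0 1; rewrite !mulmx2E => E01.
  apply: subr0_eq; rewrite -(subrr (Y 0 0 * X 0 1 + Y 0 1 * X 1 1)) -{1}E01.
  by ring.
have diag10 : (X 0 0 - X 1 1) * Y 1 0 = X 1 0 * (Y 0 0 - Y 1 1).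
  have := E 1 0; rewrite !mulmx2E => E10.
  apply: subr0_eq; rewrite -(subrr (Y 1 0 * X 0 0 + Y 1 1 * X 1 0)) -{2}E10.
  by ring.
have solve b : X 0 1 = b * Y 0 1 -> X 1 0 = b * Y 1 0 ->
    X 0 0 - X 1 1 = b * (Y 0 0 - Y 1 1) -> exists a b, X = a%:M + b *: Y.
  move=> X01 X10 Xd; exists (X 0 0 - b * Y 0 0), b.
  apply: mx2P; rewrite !mxE /= ?mulr1n ?mulr0n ?add0r ?subrK //.
  by rewrite -[LHS](subKr (X 0 0)) Xd; ring.
have [Y01|Y01] := eqVneq (Y 0 1) 0; last first.
  apply: (solve (X 0 1 / Y 0 1)); first by rewrite divfK.
    by apply: (mulIf Y01); rewrite mulrAC divfK // -offdiag.
  by apply: (mulIf Y01); rewrite diag01 [RHS]mulrAC divfK.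
have [Y10|Y10] := eqVneq (Y 1 0) 0; last first.
  apply: (solve (X 1 0 / Y 1 0)); last 2 first.
  - by rewrite divfK.
  - by apply: (mulIf Y10); rewrite diag10 [RHS]mulrAC divfK.
  by apply: (mulIf Y10); rewrite offdiag [RHS]mulrAC divfK.
have Yd : Y 0 0 - Y 1 1 != 0.
  apply: contraNneq Yns => /eqP; rewrite subr_eq0 => /eqP Yd.
  by apply/vlineP; exists (Y 0 0); apply: mx2P; rewrite !mxE /= ?mulr1 ?mulr0.
apply: (solve ((X 0 0 - X 1 1) / (Y 0 0 - Y 1 1))); last by rewrite divfK.
  by apply: (mulIf Yd); rewrite -diag01 Y01 !mulr0 mul0r.
by apply: (mulIf Yd); rewrite -diag10 Y10 !mulr0 mul0r.
Qed.

Lemma mx2_centralizer_comm (K : fieldType) (X X' Y : 'M[K]_2) :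
    Y \notin <[1%:M]>%VS -> X *m Y = Y *m X -> X' *m Y = Y *m X' ->
  X *m X' = X' *m X.
Proof.
move=> Yns /(mx2_centralizer Yns)[a [b ->]] /(mx2_centralizer Yns)[a' [b' ->]].
by apply: mx2P; rewrite !mulmx2E !mxE /=; ring.
Qed.

(** In odd dimension the Gram matrix satisfies [\det M = - \det M], so it is singular; a row vector
    that it kills gives an element of the radical. *)
Lemma skew_nondegenerate_even (K : fieldType) (V : vectType K)
    (w : {skew_symmetric V}) :
  2%:R != 0 :> K -> nondegenerate w -> ~~ odd (\dim {:V}).
Proof.
move=> two_neq0 nd; apply/negP => odd_dim.
pose b := vbasis {:V}; pose M : 'M[K]_(\dim {:V}) := \matrix_(i, j) w b`_i b`_j.
have MT : M^T = -1 *: M.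
  by apply/matrixP => i j; rewrite !mxE hermC expr1.
have : \det M == 0.
  have := det_tr M; rewrite MT detZ -signr_odd odd_dim expr1 mulN1r => /eqP.
  rewrite eq_sym -subr_eq0 opprK -mulr2n -mulr_natr.
  by rewrite mulf_eq0 (negPf two_neq0) orbF.
case/det0P=> r r0 rM.
pose u := \sum_i r 0 i *: b`_i.
have uM (j : 'I__) : w u b`_j = (r *m M) 0 j.
  rewrite /u linear_sumlz [RHS]mxE; apply: eq_bigr => i _.
  by rewrite linearZl_LR [M i j]mxE.
have u0 : u = 0.
  apply/eqP; rewrite -memv0 -(eqP nd); apply/mem_orthovP => v _.
  rewrite (coord_vbasis (memvf v)) linear_sumr big1 // => j _.
  by rewrite linearZr_LR /= uM rM mxE mulr0.
move/eqP: r0; apply; apply/rowP => i; rewrite mxE.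
by move/freeP: (basis_free (vbasisP {:V})); apply.
Qed.

Lemma coboundary_skew (K : fieldType) (g : lieAlgType K) (alpha : {scalar g}) :
  exists w : {skew_symmetric g}, forall u v, w u v = alpha (lie u v).
Proof.
pose h (u v : g) := alpha (lie u v).
have hbil : bilinear_for *%R *%R h.
  by split=> [v | u] a x y; rewrite /h ?lieDl ?lieDr ?lieZl ?lieZr linearP.
have hskew u v : h u v = (-1) ^+ true * idfun (h v u).
  by rewrite /h lieC linearN mulN1r.
have hadd_l v : zmod_morphism (h ^~ v) by move=> x y; rewrite /h lieBl linearB.
have hadd_r u : zmod_morphism (h u) by move=> x y; rewrite /h lieBr linearB.
have hZl v : scalable_for *%R (h ^~ v) by move=> a x; rewrite /h lieZl linearZ.
have hZr u : scalable_for (idfun \; *%R) (h u).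
  by move=> a x; rewrite /h lieZr linearZ.
pose hB := isBilinear.Build K g g K *%R (idfun \; *%R) h hadd_l hadd_r hZl hZr.
pose hH := isHermitianSesquilinear.Build K g true idfun h hskew.
by exists (HB.pack h hB hH : {skew_symmetric g}).
Qed.

(** * Lie algebras with nilradical L_n *)

Section Frame.
Context {K : fieldType} {g : lieAlgType K}.
Variables (n : nat) (N : {vspace g}) (e0 e1 : g) (c : nat -> {scalar g}).
Hypotheses (n2 : (2 < n)%N) (idN : lie_ideal N).
Hypothesis fr : filiform_frame n N e0 e1 c.
Implicit Types (u v w x y : g).

Local Notation T := (lie e0).

Let Ne0 := frame_e0 fr.
Let Ne1 := frame_e1 fr.
Let NT u w (Nw : w \in N) : lie u w \in N := lie_idealP _ idN u w Nw.
Let n1 : (1 < n)%N. Proof. exact: ltnW. Qed.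
Let n0 : (0 < n)%N. Proof. exact: ltnW. Qed.
Let c0e0 : c 0 e0 = 1. Proof. by rewrite (coord_e0 fr). Qed.
Let c1e0 : c 1 e0 = 0. Proof. by rewrite (coord_e0 fr). Qed.
Let c0e1 : c 0 e1 = 0. Proof. by rewrite (coord_e1 fr). Qed.
Let c1e1 : c 1 e1 = 1. Proof. by rewrite (coord_e1 fr). Qed.
Let c0T w : w \in N -> c 0 (T w) = 0. Proof. exact: coord_shift0 fr w. Qed.
Let c1T w : w \in N -> c 1 (T w) = 0. Proof. exact: coord_shift1 fr w. Qed.
Let c2T w : w \in N -> c 2 (T w) = c 1 w.
Proof. by move=> Nw; apply: coord_shift fr _ _ Nw n2. Qed.

(** The span of [e1], [T e1], [T (T e1)], ..., cut out as a hyperplane of [N]. [K^o] is [K] as a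
    vector space over itself. *)
Definition frame_abelian : {vspace g} :=
  (N :&: lker (linfun (c 0 : g -> K^o)))%VS.
Local Notation A := frame_abelian.

Lemma mem_abelian w : (w \in A) = (w \in N) && (c 0 w == 0).
Proof. by rewrite memv_cap memv_ker lfunE. Qed.

Lemma abelianP w : w \in A -> w \in N /\ c 0 w = 0.
Proof. by rewrite mem_abelian => /andP[? /eqP]. Qed.

Lemma abelian_sub w : w \in A -> w \in N.
Proof. by case/abelianP. Qed.

Lemma shift_abelian w : w \in N -> T w \in A.
Proof. by move=> Nw; rewrite mem_abelian NT //= c0T. Qed.

Lemma e1_abelian : e1 \in A.
Proof. by rewrite mem_abelian Ne1 c0e1 /=. Qed.

Lemma dim_frame_abelian : (n.-1 <= \dim A)%N.
Proof.
rewrite -(frame_dim fr) -(limg_ker_dim (linfun (c 0 : g -> K^o)) N).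
have := dimvS (subvf (linfun (c 0 : g -> K^o) @: N)); rewrite dimvf addnC.
by case: (\dim _) => [|[]] // _; rewrite leq_pred.
Qed.

Lemma lie_abelianr v w : v \in N -> w \in A -> lie v w = c 0 v *: T w.
Proof.
by move=> Nv /abelianP[Nw w0]; rewrite (frame_lie fr) // w0 scale0r subr0.
Qed.

Lemma lie_abelianl v w : v \in A -> w \in N -> lie v w = - (c 0 w *: T v).
Proof. by move=> Av Nw; rewrite lieC lie_abelianr. Qed.

Lemma abelian_lie0 v w : v \in A -> w \in A -> lie v w = 0.
Proof. by case/abelianP=> Nv v0 Aw; rewrite lie_abelianr // v0 scale0r. Qed.

Lemma frame_decomp w : w \in N ->
  exists2 v, v \in A & w = c 0 w *: e0 + c 1 w *: e1 + T v.
Proof.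
move=> Nw; have [| | | v [Nv v0 wE]] := frame_shift_surj fr
    (w := w - (c 0 w *: e0 + c 1 w *: e1)).
- by rewrite memvB ?memvD ?memvZ.
- by rewrite !(linearB, linearD, linearZ) /= c0e0 c0e1; ring.
- by rewrite !(linearB, linearD, linearZ) /= c1e0 c1e1; ring.
by exists v; rewrite ?mem_abelian ?Nv ?v0 //= -wE; module.
Qed.

Lemma abelian_decomp w : w \in A -> exists2 v, v \in A & w = c 1 w *: e1 + T v.
Proof.
case/abelianP=> /frame_decomp[v Av wE] w0; exists v => //.
by rewrite {1}wE w0 scale0r add0r.
Qed.

(** [lie u e0] lies in [N], hence acts on [A] as a multiple of [T]. This is why each application of
    [T] raises the weight by [c 0 (lie u e0)]. *)
Lemma lie_shift u w : w \in A ->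
  lie u (T w) = c 0 (lie u e0) *: T w + T (lie u w).
Proof. by move=> Aw; rewrite lie_lier lie_abelianr ?NT. Qed.

Lemma frame_top_neq0 : iter n.-2 T e1 != 0.
Proof.
suff ck k : (k.+1 < n)%N -> iter k T e1 \in N /\ c k.+1 (iter k T e1) = 1.
  have [|_ ] := ck n.-2; first by case: (n) n2 => [|[]].
  by apply: contra_eq_neq => ->; rewrite linear0 eq_sym oner_neq0.
elim: k => [_|k IHk kn]; first by [].
have [Nk ck] := IHk (ltnW kn).
by rewrite /= NT //= (coord_shift fr).
Qed.

Lemma frame_center w : w \in N -> lie (iter n.-2 T e1) w = 0.
Proof.
have nE : n.-2 = (n - 3).+1.
  by case: (n) n2 => [|[|[|]]] //= k _; rewrite !subSS subn0.
have NkT k : iter k T e1 \in N by elim: k => //= k IHk; rewrite NT.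
move=> Nw; rewrite lie_abelianl //; last by rewrite nE /= shift_abelian.
have := frame_shift_nil fr Ne1; case: (n) n2 => [|[|k]] //= _ ->.
by rewrite scaler0 oppr0.
Qed.

(** If [N] were all of [g], the last basis vector of [N] would be central. *)
Lemma not_nilpotent_complete : lie_complete g -> N != fullv.
Proof.
move=> [center0 _]; apply: contra_neqN frame_top_neq0 => /eqP NE.
by apply: center0 => w; rewrite frame_center // NE memvf.
Qed.

(* If c 0 (lie x e0) <> 0, the derivation D : e0 |-> eps' e1, (ad e0)^k e1 |->
   q (ad e0)^k e1 of N is outer and commutes with ad x modulo ad N. *)
Lemma codim1_triangular x : lie_complete g -> x \notin N ->
    (forall u, exists a, u - a *: x \in N) ->
    {in N, forall w, c 0 (lie x w) = c 0 (lie x e0) * c 0 w} ->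
  c 0 (lie x e0) = 0.
Proof.
move=> gC Nx Nfull c0x; apply/eqP/negPn/negP => a0.
pose a := c 0 (lie x e0); pose b := c 1 (lie x e1).
pose eps := c 1 (lie x e0).
(* The equation cancels the [e1]-component of [[D, ad x] e0]. It is one homogeneous equation in two
   unknowns, so it has a nonzero solution. *)
have [q [eps' [qeps0 qE]]] : exists q eps' : K,
    (q, eps') <> (0, 0) /\ q * eps = (b - a) * eps'.
  have [[-> ->] | ne0] := eqVneq (b - a, eps) (0, 0).
    by exists 1, 0; split; [case=> /eqP; rewrite oner_eq0 | ring].
  by exists (b - a), eps; split; [exact/eqP |].
pose d w := q *: (w - c 0 w *: e0) + (eps' * c 0 w) *: e1.
have dlin : linear d.
  by move=> k u v; rewrite /d !(linearD, linearZ) /=; module.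
have [D DE] := linear_lfun dlin.
have [s As sE] := frame_decomp (NT x Ne0); rewrite -/a -/eps in sE.
have [t At tE] : exists2 t, t \in A & lie x e1 = b *: e1 + T t.
  have [t At ->] := frame_decomp (NT x Ne1); exists t => //.
  by rewrite c0x // c0e1 mulr0 scale0r add0r.
have DA w : w \in N -> D w \in A.
  move=> Nw; rewrite DE mem_abelian memvD ?memvZ ?memvB ?memvZ //=.
  by rewrite !(linearD, linearN, linearZ) /= c0e0 c0e1 mulr1 subrr !mulr0 addr0.
have TD w : w \in N -> T (D w) = q *: T w + (eps' * c 0 w) *: T e1.
  by move=> Nw; rewrite DE /d lieDr !lieZr lieBr lieZr liexx scaler0 subr0.
(* On [N], [[D, ad x]] is the inner derivation by this element: it kills [A] and sends [e0] to
   [q *: T s - eps' *: T t]. *)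
have [|w Nw|z zP] := @codim1_derivation_inner _ _ N x D (eps' *: t - q *: s)
    gC idN Nx Nfull.
- move=> v w Nv Nw; rewrite (lie_abelianl (DA _ Nv)) //.
  rewrite (lie_abelianr Nv (DA _ Nw)) !TD //.
  rewrite DE /d (frame_lie fr) // !(linearB, linearZ) /= !c0T //.
  by module.
- rewrite [lie (_ - _) w]lie_abelianl //; last by rewrite memvB ?memvZ.
  rewrite !DE /d c0x // -/a !(lieDr, lieNr, lieZr) sE tE.
  apply: coord_vbasis_inj => i; rewrite !(linearD, linearN, linearZ) /=.
  by ring: qE.
have [k] := Nfull z; move: (z - _) (subrK (k *: x) z) => w wE Nw.
have zE : z = w + k *: x by rewrite wE.
(* [D] maps [N] into [A], whereas the [e0]-coordinate of [lie z e0] is [k * a]. *)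
have k0 : k = 0.
  have := congr1 (c 0) (zP _ Ne0); rewrite DE /d zE lieDl lieZl.
  rewrite !(linearD, linearN, linearZ) /= c0e0 c0e1 lieC linearN /= c0T //.
  rewrite !(mulr1, mulr0, subrr, addr0, oppr0, add0r) => /esym/eqP.
  by rewrite mulf_eq0 (negPf a0) orbF => /eqP.
move: zP; rewrite zE k0 scale0r addr0 => zP; case: qeps0; congr (_, _).
  have := congr1 (c 1) (zP _ Ne1); rewrite DE /d lie_abelianr ?e1_abelian //.
  rewrite !(linearD, linearN, linearZ) /= c0e1 c1e1 c1T // => /eqP.
  by rewrite !(mulr1, mulr0, mul0r, subr0, oppr0, addr0) => /eqP.
have := congr1 (c 1) (zP _ Ne0); rewrite DE /d lieC.
rewrite !(linearD, linearN, linearZ) /= c0e0 c1e0 c1e1 c1T // => /eqP.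
by rewrite !(mulr1, mulr0, mul0r, subr0, oppr0, addr0, add0r) => /eqP.
Qed.

(** * Triangularity of the action on N for n > 3 *)

Lemma coord_lie_frame v w : v \in N -> w \in N ->
  c 0 (lie v w) = 0 /\ c 1 (lie v w) = 0.
Proof.
move=> Nv Nw; rewrite (frame_lie fr) // !(linearD, linearN, linearZ) /=.
by rewrite !c0T // !c1T // !mulr0 oppr0 addr0.
Qed.

(* Since [e1, [e0, e1]] = 0 while [e0, [e0, e1]] <> 0. *)
Lemma coord0_lie_e1 u : (3 < n)%N -> c 0 (lie u e1) = 0.
Proof.
move=> n3; have Ae1 := e1_abelian; have ATe1 := shift_abelian Ne1.
have := lie_lier u e1 (T e1); rewrite [lie e1 (T e1)]abelian_lie0 // lie0r.
rewrite (lie_abelianr _ ATe1) ?NT // [lie u (T e1)]lie_shift //.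
rewrite [lie e1 (_ + _)]abelian_lie0 ?memvD ?memvZ ?shift_abelian ?NT // addr0.
move=> /(congr1 (c 3)); rewrite linear0 linearZ /= !(coord_shift fr) ?NT //.
by rewrite c1e1 mulr1 => <-.
Qed.

Lemma lie_abelian u w : (3 < n)%N -> w \in A -> lie u w \in A.
Proof.
move=> n3 Aw; rewrite mem_abelian NT ?(abelian_sub Aw) //=.
have [v Av ->] := abelian_decomp Aw.
rewrite lieDr lieZr lie_shift // !(linearD, linearZ) /= coord0_lie_e1 //.
by rewrite !c0T ?NT ?(abelian_sub Av) // !mulr0 !addr0.
Qed.

Lemma coord0_lie u w : (3 < n)%N -> w \in N ->
  c 0 (lie u w) = c 0 (lie u e0) * c 0 w.
Proof.
move=> n3 Nw; have [v Av {1}->] := frame_decomp Nw.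
rewrite !lieDr !lieZr !(linearD, linearZ) /= coord0_lie_e1 // mulr0 addr0.
have [_ ->] := abelianP (lie_abelian u n3 (shift_abelian (abelian_sub Av))).
by rewrite addr0 mulrC.
Qed.

Lemma coord1_lie u w : (3 < n)%N -> w \in A ->
  c 1 (lie u w) = c 1 (lie u e1) * c 1 w.
Proof.
move=> n3 Aw; have [v Av {1}->] := abelian_decomp Aw.
have Nv := abelian_sub Av.
rewrite !lieDr !lieZr lie_shift // !(linearD, linearZ) /= !c1T ?NT //.
by rewrite mulr0 !addr0 mulrC.
Qed.

(* (ad e0)^2 is an outer derivation of N commuting with ad x modulo ad N. *)
Lemma codim1_unipotent x : (3 < n)%N -> lie_complete g -> x \notin N ->
    (forall u, exists a, u - a *: x \in N) ->
  c 0 (lie x e0) = 0 -> c 1 (lie x e1) = 0.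
Proof.
move=> n3 gC Nx Nfull a0.
have Ax : lie x e0 \in A by rewrite mem_abelian NT //= a0.
pose D := (ad e0 \o ad e0)%VF.
have DE w : D w = T (T w) by rewrite comp_lfunE !adE.
have [v w Nv Nw|w Nw|z zP] := @codim1_derivation_inner _ _ N x D
    (- T (lie x e0)) gC idN Nx Nfull.
(* The cross terms [lie (T v) (T w)] of the Leibniz rule vanish because [A] is abelian. *)
- rewrite !DE (lie_lier e0 v) lieDr (lie_lier e0 (T v)) (lie_lier e0 v).
  by rewrite !(abelian_lie0 (shift_abelian Nv) (shift_abelian Nw)) addr0 add0r.
- rewrite !DE (lie_lier x e0).
  rewrite [lie (lie x e0) (T w)]abelian_lie0 ?shift_abelian // add0r.
  rewrite (lie_lier x e0) (lie_abelianl Ax) // lieDr lieNl lieNr lieZr.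
  rewrite [lie (T (lie x e0)) w]lie_abelianl ?shift_abelian ?NT // opprK.
  by rewrite addrA addrN add0r.
have [k] := Nfull z; move: (z - _) (subrK (k *: x) z) => w wE Nw.
have := zP _ Ne1.
rewrite DE -wE lieDl lieZl (lie_abelianr Nw e1_abelian) => De1.
have [//|b0] := eqVneq (c 1 (lie x e1)) 0.
(* The [e1]-coordinate of [D e1] is zero, that of [lie z e1] is [k * c 1 (lie x e1)]. *)
have k0 : k = 0.
  apply/eqP; have /eqP := congr1 (c 1) De1.
  rewrite !(linearD, linearZ) /= !c1T ?NT // mulr0 add0r eq_sym.
  by rewrite mulf_eq0 (negPf b0) orbF.
(* Now [T (T e1)] would be a multiple of [T e1]; coordinate 3 tells them apart. *)
have /eqP := congr1 (c 3) De1.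
rewrite k0 scale0r addr0 linearZ /= !(coord_shift fr) ?NT // c1e1.
by rewrite (coord_e1 fr) // mulr0 oner_eq0.
Qed.

(** * The Heisenberg algebra, n = 3 *)

Lemma frame3_decomp w : n = 3 -> w \in N ->
  w = c 0 w *: e0 + c 1 w *: e1 + c 2 w *: T e1.
Proof.
move=> n3 Nw; have [v Av wE] := frame_decomp Nw.
have [v' Av' vE] := abelian_decomp Av.
have TTv : T (T v') = 0.
  by have := frame_shift_nil fr (abelian_sub Av'); rewrite n3.
have Tv : T v = c 1 v *: T e1 by rewrite {1}vE lieDr lieZr TTv addr0.
suff -> : c 2 w = c 1 v by rewrite -Tv.
rewrite wE !(linearD, linearZ) /= c2T ?(abelian_sub Av) //.
by rewrite (coord_e0 fr) // (coord_e1 fr) // !mulr0 !add0r.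
Qed.

Lemma frame3_shift w : n = 3 -> w \in N -> T w = c 1 w *: T e1.
Proof.
move=> n3 Nw; rewrite {1}(frame3_decomp n3 Nw).
rewrite !lieDr !lieZr liexx scaler0 add0r.
by have := frame_shift_nil fr Ne1; rewrite n3 /= => ->; rewrite scaler0 addr0.
Qed.

(** The bracket identifies this line with the exterior square of [N / [N, N]], so [u] acts on it by
    the trace. *)
Lemma frame3_lie_center u : n = 3 ->
  lie u (T e1) = (c 0 (lie u e0) + c 1 (lie u e1)) *: T e1.
Proof.
move=> n3; rewrite lie_shift ?e1_abelian //.
by rewrite (frame3_shift (w := lie u e1)) ?NT // scalerDl.
Qed.

Lemma frame3_lie v w : n = 3 -> v \in N -> w \in N ->
  lie v w = (c 0 v * c 1 w - c 0 w * c 1 v) *: T e1.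
Proof.
move=> n3 Nv Nw; rewrite (frame_lie fr) //.
by rewrite (frame3_shift n3 Nv) (frame3_shift n3 Nw); module.
Qed.

(* The grading derivation diag(1, 1, 2) of N commutes with ad x modulo ad N. *)
Lemma codim1_heisenberg x : n = 3 -> lie_complete g -> x \notin N ->
    (forall u, exists a, u - a *: x \in N) ->
  [/\ c 1 (lie x e0) = 0, c 0 (lie x e1) = 0
    & c 0 (lie x e0) = c 1 (lie x e1)].
Proof.
move=> n3 gC Nx Nfull.
have c2Te1 : c 2 (T e1) = 1 by rewrite c2T.
have c2e0 : c 2 e0 = 0 by rewrite (coord_e0 fr).
have c2e1 : c 2 e1 = 0 by rewrite (coord_e1 fr).
pose d w := w + c 2 w *: T e1.
have dlin : linear d.
  by move=> k u v; rewrite /d !(linearD, linearZ) /=; module.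
have [D DE] := linear_lfun dlin.
have xE w : w \in N -> c 2 (lie x w) = c 0 w * c 2 (lie x e0)
    + c 1 w * c 2 (lie x e1) + c 2 w * (c 0 (lie x e0) + c 1 (lie x e1)).
  move=> Nw; rewrite {1}(frame3_decomp n3 Nw) !lieDr !lieZr.
  rewrite frame3_lie_center //.
  by rewrite !(linearD, linearZ) /= c2Te1 mulr1.
(* [D] commutes with [ad x] except for the central components of [lie x e0] and [lie x e1]; the
   bracket with this combination of [e0] and [e1] produces them. *)
have [v w Nv Nw|w Nw|z zP] := @codim1_derivation_inner _ _ N x D
    (c 2 (lie x e1) *: e0 - c 2 (lie x e0) *: e1) gC idN Nx Nfull.
- have NTe1 := NT e0 Ne1.
  rewrite !DE /d (frame3_lie n3 Nv Nw) (frame3_lie n3 _ Nw) ?memvD ?memvZ //.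
  rewrite (frame3_lie n3 Nv) ?memvD ?memvZ //.
  by rewrite !(linearD, linearZ) /= !c0T // !c1T // c2Te1; module.
- rewrite !DE /d lieDr lieZr frame3_lie_center // (xE w Nw).
  rewrite [lie (_ - _) w](frame3_lie n3 _ Nw) ?memvB ?memvZ //.
  by rewrite !(linearD, linearN, linearZ) /= c0e0 c0e1 c1e0 c1e1; module.
have [k] := Nfull z; move: (z - _) (subrK (k *: x) z) => w wE Nw.
(* [D] and hence [ad z] induce the identity on [N / [N, N]], where [ad z] is [k] times [ad x]: so
   [k] is nonzero and [x] acts as a scalar. *)
have := zP _ Ne1; have := zP _ Ne0.
rewrite !DE /d c2e0 c2e1 !scale0r !addr0 -wE !lieDl !lieZl => De0 De1.
have := congr1 (c 0) De0; have := congr1 (c 1) De0.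
have := congr1 (c 0) De1; have := congr1 (c 1) De1.
rewrite !(linearD, linearZ) /= c0e0 c0e1 c1e0 c1e1.
have [-> ->] := coord_lie_frame Nw Ne0; have [-> ->] := coord_lie_frame Nw Ne1.
rewrite !add0r => k11 k01 k10 k00.
have k0 : k != 0 by apply/eqP => k0; move/eqP: k11; rewrite k0 mul0r oner_eq0.
split; first by apply/eqP; rewrite -[_ == _]orFb -(negPf k0) -mulf_eq0 -k10.
  by apply/eqP; rewrite -[_ == _]orFb -(negPf k0) -mulf_eq0 -k01.
by apply: (mulfI k0); rewrite -k00 -k11.
Qed.

(** * The filtration of A and the weights *)

Definition frame_filtration (k : nat) : {vspace g} :=
  iter k (fun U => ad e0 @: U)%VS A.
Local Notation F := frame_filtration.

Lemma frame_filtration_iter k w : w \in F k ->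
  exists2 v, v \in A & w = iter k T v.
Proof.
elim: k w => [|k IHk] w; first by exists w.
move/memv_imgP=> [v /IHk[v' Av' ->] ->]; exists v' => //=.
by rewrite adE.
Qed.

Lemma frame_filtration_sub k w : w \in F k -> w \in A.
Proof.
case/frame_filtration_iter=> v Av ->; elim: k => //= k IHk.
by rewrite shift_abelian ?(abelian_sub IHk).
Qed.

Lemma frame_filtration0 k : (n.-1 <= k)%N -> F k = 0%VS.
Proof.
move=> nk; apply/eqP; rewrite -subv0; apply/subvP => w.
rewrite -(subnK nk) => /frame_filtration_iter[v Av ->].
rewrite iterD (frame_shift_nil fr) ?(abelian_sub Av) //.
rewrite memv0; elim: (k - n.-1)%N => //= m /eqP ->.
by rewrite lie0r.
Qed.

(** The diagonal of the action on [N / [N, N]], packed as a row vector so that rank-nullity compares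
    [\dim {:g}] with [n.+2]. *)
Definition weight u : 'rV[K]_2 :=
  \row_i (if i == 0 then c 0 (lie u e0) else c 1 (lie u e1)).

Lemma weight_linear : linear weight.
Proof.
move=> a u v; apply/rowP => i; rewrite !mxE !lieDl !lieZl.
by case: ifP => _; rewrite linearD linearZ.
Qed.

Lemma weightE u a b : weight u = \row_i (if i == 0 then a else b) ->
  c 0 (lie u e0) = a /\ c 1 (lie u e1) = b.
Proof.
by move/rowP=> uE; have := uE 0; have := uE 1; rewrite !mxE.
Qed.

Lemma weight0P u : weight u = 0 <-> c 0 (lie u e0) = 0 /\ c 1 (lie u e1) = 0.
Proof.
split=> [/rowP uE | [u0 u1]]; last first.
  by apply/rowP => i; rewrite !mxE u0 u1 if_same.
by have := uE 0; have := uE 1; rewrite !mxE.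
Qed.

(** Modulo [F 1], [u] acts on [A] by [c 1 (lie u e1)]; [lie_shift] then carries the claim from [F k]
    to [F k.+1]. *)
Lemma lie_weight u w k : (3 < n)%N -> w \in F k ->
  lie u w - (k%:R * c 0 (lie u e0) + c 1 (lie u e1)) *: w \in F k.+1.
Proof.
move=> n3; elim: k w => [|k IHk] w Fw.
  rewrite mul0r add0r.
  have Aw : w \in A by [].
  have [v Av wE] := abelian_decomp Aw.
  have [v' Av' uwE] := abelian_decomp (lie_abelian u n3 Aw).
  apply/memv_imgP; exists (v' - c 1 (lie u e1) *: v).
    by rewrite memvB ?memvZ.
  rewrite adE lieBr lieZr uwE coord1_lie // {2}wE; module.
case/memv_imgP: Fw => v Fv ->.
rewrite adE lie_shift ?(frame_filtration_sub Fv) //; apply/memv_imgP.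
exists (lie u v - (k%:R * c 0 (lie u e0) + c 1 (lie u e1)) *: v).
  exact: IHk.
rewrite adE lieBr lieZr -natr1; module.
Qed.

(** The action is triangular, so commutators have zero diagonal. *)
Lemma weight_lie u v : (3 < n)%N -> weight (lie u v) = 0.
Proof.
move=> n3; apply/weight0P; rewrite !lie_liel !linearB /=.
rewrite (coord0_lie u n3 (NT v Ne0)) (coord0_lie v n3 (NT u Ne0)).
rewrite (coord1_lie u n3 (lie_abelian v n3 e1_abelian)).
rewrite (coord1_lie v n3 (lie_abelian u n3 e1_abelian)).
by split; rewrite [X in X - _]mulrC subrr.
Qed.

Lemma weight_frame w : w \in N -> weight w = 0.
Proof.
move=> Nw; apply/weight0P.
by split; [case: (coord_lie_frame Nw Ne0) | case: (coord_lie_frame Nw Ne1)].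
Qed.

Hypotheses (gC : lie_complete g) (gS : lie_solvable g) (nilN : is_nilradical N).
Hypothesis two_neq0 : 2%:R != 0 :> K.

Lemma weight_eq0 u : (3 < n)%N -> weight u = 0 -> u \in N.
Proof.
move=> n3 u0; have [phi phiE] := linear_lfun weight_linear.
have kerE v : (v \in lker phi) = (weight v == 0) by rewrite memv_ker phiE.
suff /subvP : (lker phi <= N)%VS by apply; rewrite kerE u0.
(* The flag is [N], [A], [T A], [T (T A)], ..., zero at index [n]; elements of weight zero move each
   term into the next. *)
apply: (@ideal_flag_sub_nilradical _ _ _ _
  (fun k => if k is k'.+1 then F k' else N) n) => //.
- by apply/lie_idealP => v w _; rewrite kerE weight_lie.
- case=> [|k]; apply/lie_prodvP => v w; rewrite kerE => /eqP/weight0P[v0 v1] Nw.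
    by rewrite [_ \in _]mem_abelian NT //= coord0_lie // v0 mul0r.
  have := lie_weight v n3 Nw.
  by rewrite v0 v1 mulr0 addr0 scale0r subr0.
by case: (n) n0 (frame_filtration0 (leqnn _)).
Qed.

(** * The action on the plane N / [N, N] for n = 3 *)

Section Heisenberg.
Hypothesis n3 : n = 3.

Lemma frame3_lie_eq0 u :
    c 0 (lie u e0) = 0 -> c 1 (lie u e0) = 0 ->
    c 0 (lie u e1) = 0 -> c 1 (lie u e1) = 0 ->
  {in N, forall w, c 0 (lie u w) = 0 /\ c 1 (lie u w) = 0}
    /\ lie u (T e1) = 0.
Proof.
move=> u00 u01 u10 u11; have uz : lie u (T e1) = 0.
  by rewrite frame3_lie_center // u00 u11 addr0 scale0r.
split=> // w Nw; rewrite {1 2}(frame3_decomp n3 Nw) !lieDr !lieZr uz scaler0.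
by rewrite !(linearD, linearZ) /= u00 u01 u10 u11 !linear0 !mulr0 !addr0.
Qed.

Lemma frame3_coord_eq0 w : w \in N -> c 0 w = 0 -> c 1 w = 0 ->
  w \in <[T e1]>%VS.
Proof.
move=> Nw w0 w1; rewrite (frame3_decomp n3 Nw) w0 w1 !scale0r !add0r.
by rewrite memvZ ?memv_line.
Qed.

(** The matrix acts on row vectors from the right, which reverses products in [planar_lie]. *)
Definition planar u : 'M[K]_2 :=
  \matrix_(i, j) c j (lie u (if i == 0 then e0 else e1)).

Lemma planar_linear : linear planar.
Proof.
by move=> a u v; apply/matrixP => i j; rewrite !mxE lieDl lieZl linearD linearZ.
Qed.

Lemma planar_eq0P u : planar u = 0 <->
  [/\ c 0 (lie u e0) = 0, c 1 (lie u e0) = 0, c 0 (lie u e1) = 0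
    & c 1 (lie u e1) = 0].
Proof.
split=> [/matrixP uE | [u0 u1 u2 u3]].
  have u00 := uE 0 0; have u01 := uE 0 1.
  have u10 := uE 1 0; have u11 := uE 1 1.
  by rewrite !mxE /= in u00 u01 u10 u11.
apply/matrixP => i j; rewrite !mxE.
case: ifP => _; case: j => [[|[|]]] //.
Qed.

Definition planar_coord w : 'rV[K]_2 := \row_j c j w.

Lemma planar_coord_lie u w : w \in N ->
  planar_coord (lie u w) = planar_coord w *m planar u.
Proof.
move=> Nw; apply/rowP => j; rewrite !mxE !big_ord_recl big_ord0 !mxE /=.
have cz : c j (T e1) = 0 by case: j => [[|[|]]] // ?; rewrite /= ?c0T ?c1T.
rewrite {1}(frame3_decomp n3 Nw) !lieDr !lieZr frame3_lie_center //.
by rewrite !(linearD, linearZ) /= cz !mulr0 !addr0.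
Qed.

Lemma planar_lie u v :
  planar (lie u v) = planar v *m planar u - planar u *m planar v.
Proof.
have rowE w i : row i (planar w) =
    planar_coord (lie w (if i == 0 then e0 else e1)).
  by apply/rowP => j; rewrite !mxE.
apply/row_matrixP => i; rewrite linearB /= !row_mul !rowE.
have Ni : (if i == 0 then e0 else e1) \in N by case: ifP.
rewrite -!planar_coord_lie ?NT //; apply/rowP => j.
by rewrite !mxE lie_liel linearB.
Qed.

Lemma planar_frame w : w \in N -> planar w = 0.
Proof.
move=> Nw; apply/planar_eq0P.
have [? ?] := coord_lie_frame Nw Ne0.
by have [? ?] := coord_lie_frame Nw Ne1.
Qed.

(** Such elements map [N] into the line of [T e1] and kill that line, so they form an ideal acting
    nilpotently on [N]. *)
Lemma planar_eq0 u : planar u = 0 -> u \in N.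
Proof.
move=> u0; have [phi phiE] := linear_lfun planar_linear.
have kerE v : (v \in lker phi) = (planar v == 0) by rewrite memv_ker phiE.
suff /subvP : (lker phi <= N)%VS by apply; rewrite kerE u0.
apply: (@ideal_flag_sub_nilradical _ _ _ _
  (fun k => nth 0%VS [:: N; <[T e1]>%VS] k) 2) => //.
  apply/lie_idealP => v w; rewrite !kerE planar_lie // => /eqP ->.
  by rewrite mul0mx mulmx0 subrr.
move=> k; apply/lie_prodvP => v w.
rewrite kerE => /eqP/planar_eq0P[v0 v1 v2 v3].
have [vN vz] := frame3_lie_eq0 v0 v1 v2 v3.
case: k => [|[|k]] /=; rewrite ?nth_nil.
- by move=> Nw; have [] := vN w Nw; apply: frame3_coord_eq0; rewrite ?NT.
- by case/vlineP=> a ->; rewrite lieZr vz scaler0 mem0v.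
- by rewrite memv0 => /eqP ->; rewrite lie0r mem0v.
Qed.

Lemma planar_trace u : \tr (planar u) = c 0 (lie u e0) + c 1 (lie u e1).
Proof. by rewrite mxtrace2E !mxE. Qed.

Lemma planar_coord_linear : linear planar_coord.
Proof. by move=> a u v; apply/rowP => j; rewrite !mxE linearD linearZ. Qed.

Lemma planar_trace_lie u v : \tr (planar (lie u v)) = 0.
Proof. by rewrite planar_lie linearB /= mxtrace_mulC subrr. Qed.

(** The flag is [N], the kernel of [planar y] on it, the line of [T e1], zero. The first step uses
    that the square vanishes, the last that the trace does. *)
Lemma frame3_derived_nilpotent (J : {vspace g}) y : lie_ideal J ->
    {in J, forall w, \tr (planar w) = 0} ->
    {in J, forall w, exists b, planar w = b *: planar y} ->
    planar y *m planar y = 0 ->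
  (J <= N)%VS.
Proof.
move=> idJ trJ propJ yy0.
have [psi psiE] : exists psi : 'Hom(g, 'rV[K]_2),
    forall w, psi w = planar_coord w *m planar y.
  apply: linear_lfun => a u v.
  by rewrite planar_coord_linear mulmxDl -scalemxAl.
apply: (@ideal_flag_sub_nilradical _ _ _ _
  (fun k => nth 0%VS [:: N; (N :&: lker psi)%VS; <[T e1]>%VS] k) 3) => //.
move=> [|[|[|k]]]; apply/lie_prodvP => u v Ju /=; have [b uE] := propJ u Ju.
- move=> Nv; rewrite memv_cap NT //= memv_ker psiE planar_coord_lie // uE.
  by rewrite -mulmxA -scalemxAl yy0 scaler0 mulmx0.
- case/memv_capP=> Nv; rewrite memv_ker psiE => /eqP v0.
  have := planar_coord_lie u Nv; rewrite uE -scalemxAr v0 scaler0 => /rowP uv0.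
  have := uv0 0; have := uv0 1; rewrite !mxE => *.
  by rewrite frame3_coord_eq0 ?NT.
- case/vlineP=> a ->; rewrite lieZr frame3_lie_center // -planar_trace trJ //.
  by rewrite scale0r scaler0 mem0v.
- by rewrite ?nth_nil memv0 => /eqP ->; rewrite lie0r mem0v.
Qed.

(* Otherwise the last derived ideal J not inside N acts on the plane N / [N, N]
   by multiples of one traceless Y. Either Y^2 = 0 and J is nilpotent, or Y is
   invertible, and then it is central in the image of g, so that this image is
   commutative. *)
Lemma frame3_derived_sub : (lie_prodv (fullv : {vspace g}) fullv <= N)%VS.
Proof.
have [phi phiE] := linear_lfun planar_linear.
have kerE v : (v \in lker phi) = (planar v == 0) by rewrite memv_ker phiE.
have [tau tauE] : exists tau : 'Hom(g, K^o), forall u, tau u = \tr (planar u).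
  by apply: linear_lfun => a u v; rewrite planar_linear linearP.
have [d gd0] := gS.
(* Indices start at 1, so that every term lies in the derived ideal, where traces vanish. *)
have : (derived_series (fullv : {vspace g}) d.+1 <= N)%VS.
  rewrite /= gd0; apply/lie_prodvP => u v; rewrite memv0 => /eqP -> _.
  by rewrite lie0l mem0v.
elim: d {gd0} => // d IHd sdN; apply: IHd.
set J := derived_series _ d.+1 in sdN *.
have idJ : lie_ideal J.
  by apply/derived_series_ideal/lie_prodvP => u v *; rewrite memvf.
have trJ w : w \in J -> \tr (planar w) = 0.
  have sJ : (J <= lker tau)%VS.
    by apply/lie_prodvP => u v _ _; rewrite memv_ker tauE planar_trace_lie.
  by move=> /(subvP sJ); rewrite memv_ker tauE => /eqP.
rewrite -[(_ <= _)%VS]negbK; apply/negP => /subvPn[y Jy Ny].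
have Y0 : planar y != 0 by apply: contraNneq Ny; apply: planar_eq0.
have Yns : planar y \notin <[1%:M]>%VS.
  apply/vlineP => -[a YE]; have := trJ y Jy; rewrite YE mxtraceZ mxtrace1.
  move/eqP; rewrite mulf_eq0 (negPf two_neq0) orbF => /eqP a0.
  by move: Y0; rewrite YE a0 scale0r eqxx.
(* [lie w y] is in the next derived term, hence in [N]: [planar w] commutes with [planar y], and
   tracelessness removes its scalar part. *)
have propJ w : w \in J -> exists b, planar w = b *: planar y.
  move=> Jw; have : planar (lie w y) = 0.
    by apply/planar_frame/(subvP sdN)/memv_lie.
  rewrite planar_lie => /eqP; rewrite subr_eq0 => /eqP/esym.
  case/(mx2_centralizer Yns)=> a [b wE]; exists b; rewrite wE.
  have := trJ w Jw; rewrite wE linearD linearZ /= trJ // mulr0 addr0.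
  rewrite mxtrace_scalar -mulr_natr => /eqP.
  rewrite mulf_eq0 (negPf two_neq0) orbF => /eqP ->.
  by rewrite -scalemx1 scale0r add0r.
(* Cayley-Hamilton for a traceless matrix; [delta] is minus the determinant. *)
have [delta YY] : exists delta, planar y *m planar y = delta%:M.
  exists (planar y 0 0 ^+ 2 + planar y 0 1 * planar y 1 0).
  have := trJ y Jy; rewrite mxtrace2E => /eqP; rewrite addr_eq0 => /eqP YE.
  by apply: mx2P; rewrite mulmx2E [RHS]mxE /= ?mulr1n ?mulr0n YE; ring.
have [delta0 | delta0] := eqVneq delta 0.
  move/negP: Ny; apply; apply: subvP Jy.
  apply: (frame3_derived_nilpotent (y := y)) => //.
  by rewrite YY delta0 -scalemx1 scale0r.
(* The commutator is [b *: planar y]. Multiplied by [planar y] it has trace 0 on one side and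
   [2 * b * delta] on the other, so [b = 0]. *)
have comm u : planar u *m planar y = planar y *m planar u.
  have [|b] := propJ (lie u y); first exact: (lie_idealP _ idJ).
  rewrite planar_lie => uyE.
  have := congr1 (fun M => \tr (planar y *m M)) uyE.
  rewrite mulmxBr linearB /= mulmxA [\tr (_ *m (planar u *m _))]mxtrace_mulC.
  rewrite -[planar u *m _ *m _]mulmxA [\tr (planar u *m _)]mxtrace_mulC subrr.
  rewrite -scalemxAr YY linearZ /= mxtrace_scalar => /esym/eqP.
  rewrite mulf_eq0 -mulr_natr mulf_eq0 (negPf delta0) (negPf two_neq0) !orbF.
  by move=> /eqP b0; move/eqP: uyE; rewrite b0 scale0r subr_eq0 => /eqP.
have : (lie_prodv fullv fullv <= lker phi)%VS.
  apply/lie_prodvP => u v _ _; rewrite kerE planar_lie.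
  by rewrite (mx2_centralizer_comm Yns (comm v) (comm u)) subrr.
move/subvP/(_ y); rewrite kerE (negPf Y0) => /(_ _)/notF; apply.
by apply: subvP Jy; apply: lie_prodvS; apply: subvf.
Qed.

(** The image of [planar] is commutative, so it consists of scalars or lies in the span of [1%:M]
    and one non-scalar matrix; the kernel is [N]. *)
Lemma frame3_dim_le : (\dim {:g} <= n.+2)%N.
Proof.
have [phi phiE] := linear_lfun planar_linear.
have kerE : lker phi = N.
  apply/eqP; rewrite eqEsubv; apply/andP; split; apply/subvP => v.
    by rewrite memv_ker phiE => /eqP; apply: planar_eq0.
  by move=> Nv; rewrite memv_ker phiE planar_frame.
rewrite -(limg_ker_dim phi fullv) kerE (capv_idPr (subvf _)) (frame_dim fr).
rewrite -[n.+2]addn2 leq_add2l.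
have comm u v : planar u *m planar v = planar v *m planar u.
  have /planar_frame :=
    subvP frame3_derived_sub _ (memv_lie (memvf v) (memvf u)).
  by rewrite planar_lie => /eqP; rewrite subr_eq0 => /eqP.
have [sphi | /subvPn[_ /memv_imgP[y _ ->]]] := boolP (limg phi <= <[1%:M]>)%VS.
  by rewrite (leq_trans (dimvS sphi)) // dim_vline; case: eqP.
rewrite phiE => Yns.
have sphi : (limg phi <= <[1%:M]> + <[planar y]>)%VS.
  apply/subvP => _ /memv_imgP[u _ ->]; rewrite phiE.
  have [a [b ->]] := mx2_centralizer Yns (comm u y).
  by rewrite -scalemx1 memv_add ?memvZ ?memv_line.
rewrite (leq_trans (dimvS sphi)) // (leq_trans (dimv_add_leqif _ _)) //.
by rewrite !dim_vline; case: eqP; case: eqP.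
Qed.

End Heisenberg.

(** * The dimension of g *)

(** Codimension 0 contradicts the trivial center. In codimension 1 the lemmas on derivations make
    the weights of [x], or [planar x] when [n = 3], vanish, which puts [x] in [N]. *)
Lemma frame_dim_gt : (n.+1 < \dim {:g})%N.
Proof.
rewrite ltnNge; apply/negP => dimg.
have [x _ Nx] : exists2 x, x \in fullv & x \notin N.
  apply/subvPn/negP => gN; have /negP[] := not_nilpotent_complete gC.
  by rewrite eqEsubv subvf.
have Nfull u : exists a, u - a *: x \in N.
  have : (N + <[x]>)%VS = fullv.
    apply/eqP; rewrite eqEdim subvf (leq_trans dimg) // -(frame_dim fr).
    have := dimv_leqif_sup (addvSl N <[x]>).
    by rewrite subv_add subvv -memvE (negPf Nx) => /leqifP.
  move=> NxE; have := memvf u.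
  rewrite -NxE => /memv_addP[w Nw [_ /vlineP[a ->] ->]].
  by exists a; rewrite addrK.
have [n3 | n3] := ltnP 3 n.
  have a0 := codim1_triangular gC Nx Nfull (fun w => coord0_lie x n3).
  have b0 := codim1_unipotent n3 gC Nx Nfull a0.
  by move/negP: Nx; apply; apply: weight_eq0 => //; apply/weight0P.
have {}n3 : n = 3 by apply/eqP; rewrite eqn_leq n3.
have [x01 x10 x00] := codim1_heisenberg n3 gC Nx Nfull.
have a0 : c 0 (lie x e0) = 0.
  apply: (codim1_triangular gC Nx Nfull) => w Nw.
  rewrite {1}(frame3_decomp n3 Nw) !lieDr !lieZr frame3_lie_center //.
  by rewrite !(linearD, linearZ) /= c0T // x10 !mulr0 !addr0 mulrC.
move/negP: Nx; apply; apply: planar_eq0 => //; apply/planar_eq0P.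
by rewrite -x00 a0 x01 x10.
Qed.

Lemma weight_lker (phi : 'Hom(g, 'rV[K]_2)) : (3 < n)%N -> phi =1 weight ->
  lker phi = N.
Proof.
move=> n3 phiE; apply/eqP; rewrite eqEsubv; apply/andP; split; apply/subvP => v.
  by rewrite memv_ker phiE => /eqP; apply: weight_eq0.
by move=> Nv; rewrite memv_ker phiE weight_frame.
Qed.

(** The weight map has kernel [N], of codimension at least 2, hence rank 2. *)
Lemma weight_surjective a b : (3 < n)%N ->
  exists u, c 0 (lie u e0) = a /\ c 1 (lie u e1) = b.
Proof.
move=> n3; have [phi phiE] := linear_lfun weight_linear.
have imphi : limg phi = fullv.
  apply/eqP; rewrite eqEdim subvf dimvf dim_matrix mul1r.
  have := frame_dim_gt; rewrite -(limg_ker_dim phi fullv) (weight_lker n3 phiE).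
  by rewrite (capv_idPr (subvf _)) (frame_dim fr) -addn2 leq_add2l.
have := memvf (\row_(i < 2) (if i == 0 then a else b)).
rewrite -imphi => /memv_imgP[u _]; rewrite phiE => /esym uE; exists u.
exact: weightE uE.
Qed.

Lemma frame3_dim : n = 3 -> \dim {:g} = 5.
Proof.
move=> n3; apply/eqP; rewrite eqn_leq; have := frame_dim_gt.
by have := frame3_dim_le n3; rewrite n3 => -> ->.
Qed.

Lemma weight_decomp x y u : (3 < n)%N ->
    c 0 (lie x e0) = 1 -> c 1 (lie x e1) = 0 ->
    c 0 (lie y e0) = 0 -> c 1 (lie y e1) = 1 ->
  exists a b d p, p \in A /\ u = a *: x + b *: y + d *: e0 + p.
Proof.
move=> n3 x0 x1 y0 y1.
pose a := c 0 (lie u e0); pose b := c 1 (lie u e1).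
pose w := u - (a *: x + b *: y).
have Nw : w \in N.
  apply: weight_eq0 => //; apply/weight0P; rewrite /w !lieBl !lieDl !lieZl.
  rewrite !(linearB, linearD, linearZ) /= x0 x1 y0 y1.
  by rewrite !mulr1 !mulr0 addr0 add0r !subrr.
exists a, b, (c 0 w), (w - c 0 w *: e0); split; last by rewrite /w; module.
by rewrite mem_abelian memvB ?memvZ //= linearB linearZ /= c0e0 mulr1 subrr.
Qed.

(** * Closed forms when n > 3 *)

Section Symplectic.
Variable w : {skew_symmetric g}.
Hypothesis w_closed :
  forall x y z, w (lie x y) z + w (lie y z) x + w (lie z x) y = 0.

(* For y of weights (0, 1), closedness gives 2 w(p, q) = - w([y, p] - p, q)
   - w(p, [y, q] - q), where both terms are deeper in the filtration. *)
Lemma abelian_isotropic : (3 < n)%N -> {in A &, forall p q, w p q = 0}.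
Proof.
move=> n3; have [y [y0 y1]] := weight_surjective 0 1 n3.
have yF k p : p \in F k -> lie y p - p \in F k.+1.
  by move=> /(lie_weight y n3); rewrite y0 y1 mulr0 add0r scale1r.
(* [m] bounds how far [j + k] is from [2 (n - 1)]; at [m = 0] one of [F j], [F k] is zero. *)
suff IH m : forall j k p q, (n.-1.*2 <= j + k + m)%N ->
    p \in F j -> q \in F k -> w p q = 0.
  by move=> p q Ap Aq; apply: (IH n.-1.*2 0 0).
elim: m => [|m IHm] j k p q jk Fp Fq.
  have [nj | jn] := leqP n.-1 j.
    move: Fp; rewrite frame_filtration0 // memv0 => /eqP ->.
    by rewrite linear0l.
  have nk : (n.-1 <= k)%N.
    rewrite addn0 -addnn in jk.
    by rewrite -(leq_add2l n.-1) (leq_trans jk) // leq_add2r ltnW.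
  by move: Fq; rewrite frame_filtration0 // memv0 => /eqP ->; rewrite linear0r.
have Ap := frame_filtration_sub Fp; have Aq := frame_filtration_sub Fq.
have := w_closed y p q; rewrite (abelian_lie0 Ap Aq) linear0l addr0.
rewrite [X in _ + X]hermC (lieC q) linearNr /= expr1 mulN1r opprK.
rewrite -(subrK p (lie y p)) -(subrK q (lie y q)) linearDl linearDr /=.
rewrite (IHm j.+1 k (lie y p - p) q) ?yF ?addSn -?addnS //.
rewrite (IHm j k.+1 p (lie y q - q)) ?yF ?[(j + _.+1)%N]addnS ?addSn -?addnS //.
rewrite !add0r -mulr2n -mulr_natr => /eqP.
by rewrite mulf_eq0 (negPf two_neq0) orbF => /eqP.
Qed.

Lemma symplectic_le4 : (3 < n)%N -> nondegenerate w -> (n <= 4)%N.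
Proof.
move=> n3 nd; rewrite leqNgt; apply/negP => n4.
have [x [x0 x1]] := weight_surjective 1 0 n3.
have [y [y0 y1]] := weight_surjective 0 1 n3.
(* [g] is spanned by [A], [e0], [x], [y] and [A] is isotropic, so [U] lies in the radical; three
   conditions on a space of dimension at least [n - 1 > 3] leave it nonzero. *)
pose U := (A :&: orthov w <[e0]> :&: orthov w <[x]> :&: orthov w <[y]>)%VS.
have dimU : (0 < \dim U)%N.
  have le1 V v m : (m.+1 <= \dim V)%N -> (m <= \dim (V :&: orthov w <[v]>))%N.
    move=> mV; apply: leq_trans (leq_dim_orthov1 w v V).
    by rewrite -ltnS prednK // (leq_trans _ mV).
  do 3! apply: (le1); apply: leq_trans dim_frame_abelian.
  by case: (n) n4.
have [u Uu u0] : exists2 u, u \in U & u != 0.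
  by exists (vpick U); rewrite ?memv_pick // vpick0 -dimv_eq0 -lt0n.
move/eqP: u0; apply; apply/eqP; rewrite -memv0 -(eqP nd).
apply/mem_orthovP => v _.
case/memv_capP: Uu => /memv_capP[/memv_capP[Au]].
rewrite !mem_orthov1 => /eqP ue0 /eqP ux /eqP uy.
have [a [b [d [p [Ap ->]]]]] := weight_decomp v n3 x0 x1 y0 y1.
rewrite !linearDr !linearZr_LR /= ue0 ux uy abelian_isotropic //.
by rewrite !mulr0 !addr0.
Qed.

End Symplectic.

(** * A symplectic form when n = 4 *)

Lemma abelian4_decomp p : n = 4 -> p \in A ->
  exists p2 p3, p = c 1 p *: e1 + p2 *: T e1 + p3 *: T (T e1).
Proof.
move=> n4 Ap; have [v Av pE] := abelian_decomp Ap.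
have [v' Av' vE] := abelian_decomp Av.
have [v'' Av'' v'E] := abelian_decomp Av'.
have TTT : T (T (T v'')) = 0.
  by have := frame_shift_nil fr (abelian_sub Av''); rewrite n4.
exists (c 1 v), (c 1 v'); rewrite {1}pE {1}vE {1}v'E !lieDr !lieZr TTT.
by rewrite addr0 addrA.
Qed.

Lemma frame4_symplectic : n = 4 -> lie_symplectic g.
Proof.
move=> n4; have n3 : (3 < n)%N by rewrite n4.
have [x [x0 x1]] := weight_surjective 1 0 n3.
have [y [y0 y1]] := weight_surjective 0 1 n3.
pose t := c 3 (lie x e1); pose t' := c 3 (lie y e1).
(* alpha = s e_2^* + e_4^* has a nondegenerate differential iff
   t - 2 (s + t') <> 0. *)
pose s := (t - 1) / 2%:R - t'.
have sE : t - 2%:R * (s + t') = 1.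
  by rewrite /s subrK mulrC divfK // subKr.
have [alpha alphaE] : exists alpha : {scalar g},
    forall u, alpha u = s * c 1 u + c 3 u.
  pose h u := s * c 1 u + c 3 u.
  have hlin : scalar h by move=> a u v; rewrite /h !linearP; ring.
  by exists (HB.pack h (GRing.isLinear.Build K g K *%R h hlin) : {scalar g}).
have [w wE] := coboundary_skew alpha.
exists w; split; last first.
  move=> u v z; rewrite !wE -!linearD /=.
  rewrite (lieC (lie u v)) (lieC (lie v z)) (lieC (lie z u)) -!opprD.
  by rewrite -addrA addrC lie_jacobi oppr0 linear0.
have NTe1 := NT e0 Ne1.
have al1 : alpha (T e1) = 0.
  by rewrite alphaE c1T // (coord_shift fr) // (coord_e1 fr) // mulr0 addr0.
have al2 : alpha (T (T e1)) = 1.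
  by rewrite alphaE c1T // !(coord_shift fr) // c1e1 mulr0 add0r.
have F2 : T (T e1) \in F 2.
  by rewrite -!adE !memv_img ?e1_abelian.
have top u : lie u (T (T e1)) =
    (2%:R * c 0 (lie u e0) + c 1 (lie u e1)) *: T (T e1).
  have := lie_weight u n3 F2; rewrite frame_filtration0 ?n4 // memv0 subr_eq0.
  by move/eqP.
have A1 : T e1 \in A by apply: shift_abelian.
have A2 : T (T e1) \in A by apply: shift_abelian.
have top0 : T (T (T e1)) = 0.
  by have := frame_shift_nil fr Ne1; rewrite n4.
have alx : alpha (lie x e1) = t by rewrite alphaE x1 mulr0 add0r.
have aly : alpha (lie y e1) = s + t' by rewrite alphaE y1 mulr1.
(* A radical element [u] is tested against [T (T e1)], [e1], [T e1], which kills its components on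
   [x], [y], [e0], and then against [e0], [x], [y], which kills the rest. *)
rewrite /nondegenerate -subv0; apply/subvP => u /mem_orthovP rad.
have {}rad v : alpha (lie u v) = 0 by rewrite -wE rad ?memvf.
have [a [b [d [p [Ap uE]]]]] := weight_decomp u n3 x0 x1 y0 y1.
have ab : a * 2%:R + b = 0.
  have := rad (T (T e1)).
  rewrite uE !lieDl !lieZl (abelian_lie0 Ap A2) top0 !top.
  rewrite x0 x1 y0 y1 scaler0 !(linearD, linearZ) /= linear0 al2.
  by move=> <-; ring.
have a0 : a = 0.
  have := rad e1; rewrite uE !lieDl !lieZl (abelian_lie0 Ap e1_abelian).
  rewrite !(linearD, linearZ) /= linear0 al1 alx aly mulr0 !addr0.
  have -> : b = - (a * 2%:R) by apply/eqP; rewrite -addr_eq0 addrC ab.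
  by rewrite mulNr -mulrA -mulrBr sE mulr1.
have b0 : b = 0 by move: ab; rewrite a0 mul0r add0r.
have d0 : d = 0.
  have := rad (T e1).
  rewrite uE a0 b0 !scale0r !add0r lieDl lieZl (abelian_lie0 Ap A1).
  by rewrite addr0 linearZ /= al2 mulr1.
move: uE; rewrite a0 b0 d0 !scale0r !add0r => {a b d ab a0 b0 d0} uE; subst p.
have [p2 [p3 uE]] := abelian4_decomp n4 Ap; move: (c 1 u) uE => p1 uE.
have p20 : p2 = 0.
  have := rad e0; rewrite lieC linearN /= {1}uE !lieDr !lieZr.
  rewrite top0 scaler0 addr0 linearD !linearZ /= al1 al2.
  by rewrite mulr0 add0r mulr1 => /eqP; rewrite oppr_eq0 => /eqP.
have radx z : alpha (lie z u) = 0 by rewrite lieC linearN /= rad oppr0.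
have px : p1 * t + p3 * 2%:R = 0.
  have := radx x; rewrite {1}uE p20 scale0r addr0 lieDr !lieZr top x0 x1.
  by rewrite linearD !linearZ /= alx al2 => <-; ring.
have py : p1 * (s + t') + p3 = 0.
  have := radx y; rewrite {1}uE p20 scale0r addr0 lieDr !lieZr top y0 y1.
  by rewrite linearD !linearZ /= aly al2 => <-; ring.
(* The system [px], [py] in [p1], [p3] has determinant [t - 2 (s + t')], which is 1 by the choice of
   [s]. *)
have p10 : p1 = 0.
  have <- : p1 * (t - 2%:R * (s + t')) = p1 by rewrite sE mulr1.
  have -> : p1 * (t - 2%:R * (s + t')) =
      (p1 * t + p3 * 2%:R) - 2%:R * (p1 * (s + t') + p3) by ring.
  by rewrite px py mulr0 subr0.
have p30 : p3 = 0 by move: py; rewrite p10 mul0r add0r.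
by rewrite memv0 uE p10 p20 p30 !scale0r !addr0.
Qed.

(** * The equivalence *)

Lemma frame_symplectic_iff : lie_symplectic g <-> n = 4.
Proof.
split; last exact: frame4_symplectic.
case=> w [nd closed]; have [n3 | n3] := ltnP 3 n.
  by apply/eqP; rewrite eqn_leq n3 andbT; apply: symplectic_le4 nd.
have {}n3 : n = 3 by apply/eqP; rewrite eqn_leq n3.
by have := skew_nondegenerate_even two_neq0 nd; rewrite frame3_dim.
Qed.

End Frame.

Lemma real_or_complex_two_neq0 (R : realType) (K : fieldType) :
  real_or_complex R K -> 2%:R != 0 :> K.
Proof. by case; rewrite Num.Theory.pnatr_eq0. Qed.

Theorem proposition3 (R : realType) (K : fieldType) (hK : real_or_complex R K)
    (n : nat) (hn : (3 <= n)%N) (g : lieAlgType K)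
    (hcomplete : lie_complete g) (hsolvable : lie_solvable g)
    (hnilradical : exists2 N : {vspace g},
       is_nilradical N & lie_isomorphic_to (filiform K n) N) :
  lie_symplectic g <-> n = 4%N.
Proof.
have [N nilN Niso] := hnilradical; have [idN _ _] := nilN.
have [e0 [e1 [c fr]]] := filiform_frame_exists Niso hn.
exact: (frame_symplectic_iff hn idN fr hcomplete hsolvable nilN
  (real_or_complex_two_neq0 hK)).
Qed.
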